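(* Let $\mathcal R$ denote the set of partitions in which any two parts differ by at least 2, and let $A_{7,3}(n)$ denote the number of partitions of $n$ into parts $\not\equiv 0,\pm3\pmod 7$. Then, for every $n\ge 0$, $$A_{7,3}(n)=\sum_{\tilde\pi\in\mathcal R,\ \sigma(\tilde\pi)=n}\omega_5(\tilde\pi),$$ where $\omega_5(\tilde\pi)$ is the product of Fibonacci-number weights of the strings of $\tilde\pi$ defined in the context.
   Context: For a partition $\pi$, $\sigma(\pi)$ denotes the sum of its parts. The Fibonacci numbers are $F_0=0$, $F_1=1$, $F_n=F_{n-1}+F_{n-2}$ for $n\ge2$. Given $\tilde\pi\in\mathcal R$, a string $\psi$ in $\tilde\pi$ is a maximal sequence of parts of $\tilde\pi$ in which the difference between consecutive parts is $\le 3$ (so every such difference is 2 or 3, and distinct strings are separated by gaps $\ge4$). Every $\tilde\pi\in\mathcal R$ decomposes uniquely into strings. For a string $\psi$, let $\eta=\eta(\psi)$ be the number of gaps (differences between consecutive parts) in $\psi$ equal to 3. The weight of $\psi$ is $$\omega_5(\psi)=\begin{cases}F_{\eta+2},&\text{if }1\in\psi,\\ F_{\eta+3},&\text{if }1\notin\psi,\end{cases}$$ where $1\in\psi$ means that 1 is a part in $\psi$. The weight of $\tilde\pi$ is $\omega_5(\tilde\pi)=\prod_{\psi}\omega_5(\psi)$, the product over all strings $\psi$ of $\tilde\pi$ (the empty product is 1). *)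

(* Defs.v *)
From HB Require Import structures.
From mathcomp Require Import all_boot.

Set Implicit Arguments.
Unset Strict Implicit.
Unset Printing Implicit Defensive.

(* Parts are listed in nonincreasing order. *)
Definition is_part_of (n : nat) (s : seq nat) : bool :=
  [&& sorted geq s, 0 \notin s & sumn s == n].

Record intpart (n : nat) : Type :=
  IntPart { parts :> seq nat; partsP : is_part_of n parts }.

HB.instance Definition _ (n : nat) := [isSub for @parts n].
HB.instance Definition _ (n : nat) := [Countable of intpart n by <:].

Lemma size_intpart (n : nat) (p : intpart n) : size (map (@inord n) p) <= n.
Proof.
case: p => s /= /and3P[_ s0 /eqP <-]; rewrite size_map.
elim: s s0 => //= -[//|x] s IH; rewrite inE /= => /IH le_s.
by rewrite addSn ltnS (leq_trans le_s) ?leq_addl.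
Qed.

Lemma intpart_le (n : nat) (p : intpart n) (x : nat) : x \in (p : seq nat) -> x <= n.
Proof.
case: p => s /= /and3P[_ _ /eqP <-].
elim: s => //= y s IH; rewrite inE => /predU1P[->|/IH le_x].
  exact: leq_addr.
by rewrite (leq_trans le_x) ?leq_addl.
Qed.

Definition bseq_of_intpart (n : nat) (p : intpart n) : {bseq n of 'I_n.+1} :=
  Bseq (size_intpart p).

Definition intpart_of_bseq (n : nat) (b : {bseq n of 'I_n.+1}) : option (intpart n) :=
  insub (map val b).

Lemma bseq_of_intpartK (n : nat) :
  pcancel (@bseq_of_intpart n) (@intpart_of_bseq n).
Proof.
move=> p; rewrite /intpart_of_bseq /= -map_comp map_id_in ?valK //.
by move=> x /intpart_le le_x /=; rewrite inordK.
Qed.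

HB.instance Definition _ (n : nat) : isFinite (intpart n) :=
  PCanIsFinite (@bseq_of_intpartK n).

(* 4 stands for -3 modulo 7. *)
Definition A73 (n : nat) : nat :=
  #|[set p : intpart n |
      all (fun i => [&& i != 0 %[mod 7], i != 3 %[mod 7] & i != 4 %[mod 7]])
          p]|.

Definition in_R (s : seq nat) : bool := pairwise (fun x y => y + 2 <= x) s.

Fixpoint fib (n : nat) : nat :=
  match n with
  | 0 => 0
  | 1 => 1
  | (n''.+1 as n').+1 => fib n' + fib n''
  end.

(* The differences between consecutive parts of a nonincreasing sequence. *)
Definition gaps (s : seq nat) : seq nat :=
  if s is x :: s' then pairmap subn x s' else [::].

(* For a nonincreasing [s], the four lemmas below characterize [strings s] as
   the decomposition of [s] into its maximal runs with all gaps <= 3. *)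
Fixpoint strings (s : seq nat) : seq (seq nat) :=
  if s is x :: s' then
    match strings s' with
    | (y :: t) :: ss =>
        if x - y <= 3 then (x :: y :: t) :: ss else [:: x] :: (y :: t) :: ss
    | _ => [:: [:: x]]
    end
  else [::].

Lemma strings_neq0 (s : seq nat) : [::] \notin strings s.
Proof.
elim: s => //= x s; case: (strings s) => [|[|y t] ss] //=.
by case: ifP; rewrite !inE.
Qed.

Lemma flatten_strings (s : seq nat) : flatten (strings s) = s.
Proof.
elim: s => //= x s; have := strings_neq0 s.
case: (strings s) => [|[|y t] ss] //= _; first by move=> <-.
by case: ifP => _ /= <-.
Qed.

Lemma gaps_strings (s psi : seq nat) :
  psi \in strings s -> all (fun d => d <= 3) (gaps psi).
Proof.
elim: s psi => //= x s; case: (strings s) => [|[|y t] ss] IH psi /=.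
- by rewrite inE => /eqP->.
- by rewrite inE => /eqP->.
case: ifP => xy; rewrite inE => /predU1P[->|psi_in] //=; last exact: IH.
  by rewrite xy; apply: (IH (y :: t)); rewrite mem_head.
by apply: IH; rewrite inE psi_in orbT.
Qed.

Lemma strings_separated (s : seq nat) :
  sorted (fun phi psi => last 0 phi - head 0 psi >= 4) (strings s).
Proof.
elim: s => //= x s; case: (strings s) => [|[|y t] ss] //=.
by case: leqP => //= [_|->]; case: ss.
Qed.

Definition eta (psi : seq nat) : nat := count_mem 3 (gaps psi).

Definition omega5_string (psi : seq nat) : nat :=
  if 1 \in psi then fib (eta psi + 2) else fib (eta psi + 3).

Definition omega5 (s : seq nat) : nat :=
  \prod_(psi <- strings s) omega5_string psi.

(* Main.v *)
Require Import Defs.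
From mathcomp Require Import all_boot.
From mathcomp Require Import all_algebra ring zify.

(** The theorem is the mod 7 case of the Andrews-Gordon identity, once the
    Fibonacci weights are read as a count.

    Markings. The weight of a partition of R is the number of ways to mark its
    parts with 0 or 1 so that parts at distance 2 have equal marks, parts at
    distance 3 are not both marked 1, and the part 1 is marked 0. Within a
    string the blocks of parts at distance 2 form a chain with eta + 1 elements
    on which no two neighbours are marked 1 (and which starts with a 0 if the
    string contains 1), and such chains are counted by
    Fibonacci numbers (omega5_rev).

    Generating function of R. Strip the smallest part: subtracting it from
    every part shows that the marked partitions with N parts are counted by
    q^(N^2) / (q)_N times a product of N transfer matrices of size 2, whose rows
    and columns are indexed by the marks of two consecutive parts. By the Pascal
    rules for Gaussian binomials [N, j] that product is evaluated by the
    polynomials P_N = sum_j q^(j^2) [N, j] and sum_j q^(j^2 + j) [N, j], whence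
    the generating function sum_N q^(N^2) P_N / (q)_N (marked_gf_mod, R_gf_mod).

    Evaluation. That double sum is reached from the trivial sequence
    delta_(n, 0) by three applications of the Bailey lemma (bailey_step), each
    of which multiplies the k-th coefficient on the other side by q^(k^2). The
    starting coefficients come from the finite Jacobi triple product at
    (1, q), and after three steps they are those of the finite triple product
    at (q^3, q^4) in base q^7 (jacobi_coef_dissect). So the double sum is
    (q^3; q^7)(q^4; q^7)(q^7; q^7) / (q), which is the product of the
    1 / (1 - q^a) over a not congruent to 0, 3, 4 mod 7 (andrews_gordon_mod).

    All identities are finite: Gaussian binomials give identities between
    polynomials, and the passage to the limit is a congruence modulo q^(n+1)
    in {poly int}, modulo which the q-factorials are invertible. *)

Set Implicit Arguments.
Unset Strict Implicit.
Unset Printing Implicit Defensive.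

Import GRing.Theory.

(** * Fibonacci weights as numbers of markings *)

(** Whether marks [e] below and [e'] above may be carried by consecutive parts at
    distance [d]. Every distance from 4 on is free, so that the count of markings
    is a product over strings. *)
Definition compat (e e' : bool) (d : nat) : bool :=
  if d == 2 then e == e' else if d == 3 then ~~ (e && e') else true.

(** Markings of the increasing sequence [s], when it is preceded by a part
    [c - 1] marked [e]. The shift lets [c = 0] stand for a virtual part -1: marked
    0, it forces mark 0 on a first part 1 (distance 2) and leaves every larger
    first part free, which is how strings containing 1 are told apart. *)
Fixpoint marks (e : bool) (c : nat) (s : seq nat) : nat :=
  if s is x :: s' then
    compat e false (x.+1 - c) * marks false x.+1 s' +
    compat e true (x.+1 - c) * marks true x.+1 s'
  else 1.

Lemma strings_cons x t : exists psi ss, strings (x :: t) = (x :: psi) :: ss.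
Proof.
rewrite /=; case: (strings t) => [|[|y u] ss]; try by exists [::], [::].
by case: ifP => _; [exists (y :: u), ss | exists [::], ((y :: u) :: ss)].
Qed.

Local Arguments fib : simpl never.

Lemma fibSS n : fib n.+2 = fib n.+1 + fib n. Proof. by []. Qed.

Lemma omega5_stringE psi :
  omega5_string psi = fib (eta psi + (1 \notin psi)).+1 + fib (eta psi + (1 \notin psi)).
Proof.
by rewrite /omega5_string -fibSS; case: (1 \in psi); rewrite ?addn0 ?addn1 ?addn2 ?addn3.
Qed.

(** The Fibonacci recurrence is the recurrence of the markings. If [psi] is the
    string of the largest part so far, its markings in which that part is marked
    0, resp. 1, number [fib k.+1], resp. [fib k], for [k = eta psi + (1 \notin psi)].
    A further part at distance 2 keeps this pair, one at distance 3 turns it into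
    [(fib k.+2, fib k.+1)], and one at distance at least 4 starts a new string at
    [(fib 2, fib 1)], with the total [fib k.+2] becoming the factor of [psi]. *)
Lemma omega5_catrev r x t psi ss :
    strings (x :: t) = psi :: ss ->
    0 < x -> path (fun a b => a.+2 <= b) x r ->
  omega5 (catrev r (x :: t)) =
    (fib (eta psi + (1 \notin psi)).+1 * marks false x.+1 r +
     fib (eta psi + (1 \notin psi)) * marks true x.+1 r) *
    \prod_(phi <- ss) omega5_string phi.
Proof.
elim: r x t psi ss => [|y r IH] x t psi ss Exs x0.
  by move=> _; rewrite /omega5 [catrev _ _]/= Exs big_cons omega5_stringE !muln1.
case/andP=> le_xy path_r; rewrite [catrev _ _]/=.
have [psi' [ss' E]] := strings_cons x t.
move: E; rewrite Exs => -[Epsi Ess].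
have y1 : (1 == y) = false by lia.
have Estr : strings (y :: x :: t) =
    if y - x <= 3 then (y :: psi) :: ss else [:: y] :: psi :: ss.
  transitivity (if strings (x :: t) is (z :: u) :: vs then
     if y - z <= 3 then (y :: z :: u) :: vs else [:: y] :: (z :: u) :: vs
     else [:: [:: y]]); first by [].
  by rewrite Exs Epsi.
have eta_cons : eta (y :: psi) = (y - x == 3) + eta psi by rewrite Epsi.
rewrite /= subSS.
move: Estr; have [d3|d4] := leqP (y - x) 3 => Estr.
  rewrite (IH _ _ _ _ Estr) //; last by lia.
  rewrite inE y1 /= eta_cons.
  have [d2|d2] : (y - x = 2) \/ (y - x = 3) by lia.
    by rewrite d2 /compat /= add0n; ring.
  by rewrite d2 eqxx add1n addSn fibSS /compat /=; ring.
rewrite (IH _ _ _ _ Estr) //; last by lia.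
rewrite big_cons omega5_stringE inE y1 /eta /= /compat.
rewrite !ifF; try by lia.
by rewrite /fib /= !mul1n; ring.
Qed.

Lemma omega5_rev s : all (leq 1) s -> pairwise (fun x y => x.+2 <= y) s ->
  omega5 (rev s) = marks false 0 s.
Proof.
case: s => [|x r]; first by rewrite /omega5 big_nil.
case/andP=> x0 _ pw.
have path_r : path (fun a b => a.+2 <= b) x r.
  by apply: (@pairwise_sorted _ _ (x :: r)).
rewrite /rev [catrev _ _]/= (@omega5_catrev r x [::] [:: x] [::]) // big_nil muln1.
rewrite /= inE /eta /= subn0 /compat add0n.
have [->|x1] := eqVneq x 1; first by rewrite /fib /=; ring.
have -> : (x.+1 == 2) = false by lia.
by rewrite /fib /= ?andbF /=; case: ifP => _ /=; ring.
Qed.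

(** Increasing sequences of [N] parts at most [n] with gaps at least 2, preceded
    by a virtual part [c - 1] as in [marks]; the cutoff [n] makes them finitely
    many and does not matter modulo [q ^+ n.+1]. *)
Fixpoint gapped (n N c : nat) : seq (seq nat) :=
  if N is N'.+1 then
    [seq x :: s | x <- index_iota c.+1 n.+1, s <- gapped n N' x.+1]
  else [:: [::]].

Lemma mem_gapped n N c s : (s \in gapped n N c) =
  [&& size s == N, all (fun x => c < x <= n) s & pairwise (fun x y => x.+2 <= y) s].
Proof.
elim: N c s => [|N IH] c s; first by case: s.
apply/allpairsPdep/idP => [[x [t [x_in]]]|].
  rewrite mem_index_iota in x_in.
  rewrite IH => /and3P[/eqP <- /allP t_in pw] -> /=.
  rewrite eqxx pw andbT /=; apply/andP; split; last by apply/allP => y /t_in; lia.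
  by apply/andP; split; [lia | apply/allP => y /t_in; lia].
case: s => [//|x t] /= /and3P[sz /andP[x_in t_in] /andP[/allP t_gt pw]].
exists x, t; split=> //; first by rewrite mem_index_iota; lia.
rewrite IH pw andbT -eqSS sz /=; apply/allP => y y_in.
by have := allP t_in y y_in; have := t_gt y y_in; lia.
Qed.

Lemma gapped_uniq n N c : uniq (gapped n N c).
Proof.
elim: N c => [//|N IH] c /=; apply: allpairs_uniq_dep => [|//|].
  exact: iota_uniq.
by move=> [x s] [y t] _ _ /= [-> ->].
Qed.

(** * Gaussian binomials *)

Local Open Scope ring_scope.

Section QBinomial.
Variables (R : comNzRingType) (q : R).

(** The q-Pochhammer symbol $(a; q)_n$. *)
Definition qpoch (a : R) (n : nat) : R := \prod_(i < n) (1 - a * q ^+ i).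

Lemma qpoch0 a : qpoch a 0 = 1.
Proof. by rewrite /qpoch big_ord0. Qed.

Lemma qpochS a n : qpoch a n.+1 = qpoch a n * (1 - a * q ^+ n).
Proof. by rewrite /qpoch big_ord_recr. Qed.

Lemma qpochD a m n : qpoch a (m + n) = qpoch a m * qpoch (a * q ^+ m) n.
Proof.
rewrite /qpoch big_split_ord /=; congr (_ * _).
by apply: eq_bigr => i _; rewrite -mulrA -exprD.
Qed.

Lemma qpochSl a n : qpoch a n.+1 = (1 - a) * qpoch (a * q) n.
Proof. by rewrite -add1n qpochD qpochS qpoch0 expr0 expr1 mul1r mulr1. Qed.

(** The Gaussian binomial coefficient, by its first Pascal rule. *)
Fixpoint qbin (n k : nat) : R :=
  match n, k with
  | _, 0 => 1
  | 0, _.+1 => 0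
  | n'.+1, k'.+1 => qbin n' k' + q ^+ k * qbin n' k
  end.

Arguments qbin : simpl never.

Lemma qbin0 n : qbin n 0 = 1. Proof. by case: n. Qed.

Lemma qbinS n k : qbin n.+1 k.+1 = qbin n k + q ^+ k.+1 * qbin n k.+1.
Proof. by []. Qed.

Lemma qbin_small n k : (n < k)%N -> qbin n k = 0.
Proof.
by elim: n k => [|n IH] [|k] // lt_nk; rewrite qbinS !IH ?mulr0 ?addr0 // ltnW.
Qed.

Lemma qbinSr n k : (k <= n)%N ->
  qbin n.+1 k.+1 = q ^+ (n - k) * qbin n k + qbin n k.+1.
Proof.
elim: n k => [|n IH] [|k] // le_kn.
- by rewrite qbinS qbin0 qbin_small // mulr0 mul1r.
- rewrite [LHS]qbinS [in X in _ = _ + X]qbinS [in X in X = _](IH 0) //.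
  by rewrite !qbin0 !subn0 !exprS; ring.
have [->|ne_kn] := eqVneq k n.
  by rewrite qbinS (@qbin_small _ n.+2) // subnn; ring.
have lt_kn : (k < n)%N by rewrite ltn_neqAle ne_kn.
transitivity (qbin n.+1 k.+1 + q ^+ k.+2 * qbin n.+1 k.+2); first by [].
rewrite {1}(IH k) // {1}(IH k.+1) // !qbinS subSS -(subnSK lt_kn) !exprS; ring.
Qed.

(** The two Pascal rules compute the same coefficient; this is their difference. *)
Lemma qbin_absorb n k : (k <= n)%N ->
  (1 - q ^+ k.+1) * qbin n k.+1 = (1 - q ^+ (n - k)) * qbin n k.
Proof.
move=> le_kn; have := qbinSr le_kn; rewrite qbinS => E.
rewrite [RHS]mulrBl mul1r.
have -> : q ^+ (n - k) * qbin n k = qbin n k + q ^+ k.+1 * qbin n k.+1 - qbin n k.+1.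
  by rewrite E addrK.
ring.
Qed.

Lemma qbin_qpoch k l : qbin (k + l) k * qpoch q k = qpoch (q ^+ l.+1) k.
Proof.
elim: k l => [|k IH] l; first by rewrite qbin0 !qpoch0 mul1r.
rewrite addSnnS qpochS -exprS mulrCA mulrC [qbin _ _ * _]mulrC.
rewrite qbin_absorb ?leq_addr // addKn -mulrA (IH l.+1) qpochSl.
by rewrite [_ ^+ _.+1 * q]mulrC -exprS.
Qed.

Lemma qbin_fact k l : qbin (k + l) k * qpoch q k * qpoch q l = qpoch q (k + l).
Proof. by rewrite qbin_qpoch addnC qpochD mulrC exprS. Qed.

Lemma expr_sqS i : q ^+ (i.+1 ^ 2) = q ^+ (i ^ 2) * q ^+ i * q ^+ i * q.
Proof. by rewrite -!exprD -exprSr; congr (q ^+ _); rewrite -!mulnn; lia. Qed.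

(** The case of the q-Chu-Vandermonde sum on which the Bailey lemma rests, in
    polynomial form. With the second Pascal rule, the sum for [L.+1] at [a] is
    [1 - a * q ^+ L.+1] times the sum for [L] at [a], plus [a * q ^+ L.+1] times
    the sum for [L] at [a * q]. *)
Lemma sum_qbin_qpoch (L : nat) (a : R) :
  \sum_(t < L.+1) q ^+ (t ^ 2) * a ^+ t * qbin L t * qpoch (a * q ^+ t.+1) (L - t) = 1.
Proof.
elim: L a => [|L IH] a.
  by rewrite big_ord_recl big_ord0 qbin0 qpoch0; ring.
have tail t : (t <= L)%N -> qpoch (a * q ^+ t.+1) (L.+1 - t) =
    (1 - a * q ^+ L.+1) * qpoch (a * q ^+ t.+1) (L - t).
  by move=> le_tL; rewrite subSn // qpochS -mulrA -exprD addSn subnKC // mulrC.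
rewrite big_ord_recl.
under eq_bigr => i _.
  rewrite lift0 qbinSr ?subSS -1?ltnS // mulrDr mulrDl; over.
rewrite big_split /= addrCA.
set S1 := \sum_(i < _) _; set S2 := \sum_(i < _) _.
have -> : S1 = a * q ^+ L.+1.
  rewrite -[RHS]mulr1 -(IH (a * q)) mulr_sumr; apply: eq_bigr => i _.
  have le_i : (i <= L)%N by rewrite -ltnS.
  have -> : q ^+ L.+1 = q * q ^+ (L - i) * q ^+ i.
    by rewrite -mulrA -exprD subnK // exprS.
  have -> : a * q * q ^+ i.+1 = a * q ^+ i.+2 by rewrite -mulrA -exprS.
  by rewrite exprMn [a ^+ _]exprS expr_sqS; ring.
suff -> : q ^+ (0 ^ 2) * a ^+ 0 * qbin L.+1 0 * qpoch (a * q ^+ 1) (L.+1 - 0) + S2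
    = 1 - a * q ^+ L.+1 by ring.
rewrite -[RHS]mulr1 -[X in _ = _ * X](IH a) mulr_sumr.
rewrite [in RHS]big_ord_recl /S2 big_ord_recr /=.
rewrite (@qbin_small L) // mulr0 mul0r addr0 !qbin0; congr (_ + _).
  by rewrite (tail 0) //; ring.
by apply: eq_bigr => i _; rewrite /bump leq0n add1n -[(L - i)%N]subSS tail //; ring.
Qed.

End QBinomial.

Arguments qbin {R} q n k : simpl never.

Section RR.
Variables (R : comNzRingType) (q : R).
Local Notation qbin := (qbin q).

(** For [e = 0] (resp. [e = 1]) and [n] parts, this is up to a power of [q] the
    numerator over $(q)_n$ of the generating function of the marked sequences
    that follow a part marked 0 (resp. 1); see [marked_gf_mod]. *)
Definition rrpoly (e n : nat) : R :=
  \sum_(j < n.+1) q ^+ (j ^ 2 + e * j) * qbin n j.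

Lemma rrpoly0S n : rrpoly 0 n.+1 = rrpoly 0 n + q ^+ n.+1 * rrpoly 1 n.
Proof.
rewrite /rrpoly big_ord_recl.
under eq_bigr => i _.
  rewrite lift0 qbinSr -1?ltnS // mulrDr; over.
rewrite big_split /= addrCA addrC; congr (_ + _).
  rewrite big_ord_recr /= [qbin n n.+1]qbin_small // mulr0 addr0 [in RHS]big_ord_recl.
  by rewrite !qbin0; congr (_ + _); apply: eq_bigr => i _; rewrite lift0.
rewrite mulr_sumr; apply: eq_bigr => i _; rewrite !mulrA -!exprD.
by congr (q ^+ _ * _); rewrite -!mulnn; have := ltn_ord i; nia.
Qed.

(** Once the left side is expanded by the second Pascal rule, what remains is
    [shift], the absorption rule summed over all [j]. *)
Lemma rrpoly1S n :
  rrpoly 1 n.+1 = q ^+ n.+1 * rrpoly 0 n + (1 - q ^+ n.+1 + q ^+ n.+1 ^+ 2) * rrpoly 1 n.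
Proof.
have shift : \sum_(j < n.+1) q ^+ (j ^ 2) * ((1 - q ^+ j) * qbin n j) =
             \sum_(j < n.+1) q ^+ (j.+1 ^ 2) * ((1 - q ^+ (n - j)) * qbin n j).
  rewrite big_ord_recl big_ord_recr /= subnn expr0 subrr !mul0r !mulr0 add0r addr0.
  by apply: eq_bigr => i _; rewrite /bump leq0n add1n qbin_absorb ?(ltnW (ltn_ord i)).
have rec : rrpoly 1 n.+1 = rrpoly 1 n +
    \sum_(j < n.+1) q ^+ (j.+1 ^ 2 + j.+1) * (q ^+ (n - j) * qbin n j).
  rewrite /rrpoly big_ord_recl.
  under eq_bigr => i _ do rewrite lift0 qbinSr -1?ltnS // mulrDr mul1n.
  rewrite big_split /= addrCA addrC; congr (_ + _).
  rewrite big_ord_recr /= [qbin n n.+1]qbin_small // mulr0 addr0 [in RHS]big_ord_recl.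
  by rewrite !qbin0; congr (_ + _); apply: eq_bigr => i _; rewrite lift0 mul1n.
pose U := \sum_(j < n.+1) q ^+ (j.+1 ^ 2) * qbin n j.
have lhs : \sum_(j < n.+1) q ^+ (j ^ 2) * ((1 - q ^+ j) * qbin n j) =
    rrpoly 0 n - rrpoly 1 n.
  rewrite -sumrB; apply: eq_bigr => j _.
  by rewrite mul0n mul1n addn0 exprD; ring.
have rhs : \sum_(j < n.+1) q ^+ (j.+1 ^ 2) * ((1 - q ^+ (n - j)) * qbin n j) =
    U - q ^+ n.+1 * rrpoly 1 n.
  rewrite mulr_sumr -sumrB; apply: eq_bigr => j _.
  have le_j : (j <= n)%N by rewrite -ltnS.
  have -> : q ^+ n.+1 = q * q ^+ (n - j) * q ^+ j by rewrite -mulrA -exprD subnK // exprS.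
  by rewrite expr_sqS mul1n exprD; ring.
have -> : rrpoly 1 n.+1 = rrpoly 1 n + q ^+ n.+1 * U.
  rewrite rec mulr_sumr; congr (_ + _); apply: eq_bigr => j _.
  rewrite !mulrA -!exprD; congr (q ^+ _ * _); have := ltn_ord j; lia.
have -> : U = rrpoly 0 n - rrpoly 1 n + q ^+ n.+1 * rrpoly 1 n.
  by apply/eqP; rewrite -subr_eq -rhs -shift lhs.
ring.
Qed.

(** A Bailey pair relative to 1 with its denominators cleared: for
    [beta n = bailey_sum alpha n / qpoch q q (n + n)] this is the usual
    $\beta_n = \sum_k \alpha_k / ((q)_{n-k} (q)_{n+k})$. *)
Definition bailey_sum (alpha : nat -> R) (n : nat) : R :=
  \sum_(k < n.+1) alpha k * qbin (n + n) (n - k).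

(** Coefficients of the triple product for [a * b = q]. The terms of index [k]
    and [- k] of the bilateral sum are merged, which makes them symmetric in [a]
    and [b] and free of negative powers; the term of index 0 counts once. *)
Definition jacobi_coef (a b : R) (k : nat) : R :=
  if k is 0 then 1 else (-1) ^+ k * q ^+ 'C(k, 2) * (a ^+ k + b ^+ k).

End RR.

(** * The Bailey lemma and the finite Jacobi triple product *)

Section Bailey.
Variables (R : idomainType) (q : R).
Hypothesis qpoch_neq0 : forall n, qpoch q q n != 0.
Local Notation qbin := (qbin q).
Local Notation qfac := (qpoch q q).
Local Notation bailey_sum := (bailey_sum q).
Local Notation jacobi_coef := (jacobi_coef q).

Lemma qpoch_qfac m n : qfac m * qpoch q (q ^+ m.+1) n = qfac (m + n).
Proof. by rewrite qpochD exprS. Qed.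

Lemma qbin_sym k l : qbin (k + l) k = qbin (k + l) l.
Proof.
apply: (mulIf (qpoch_neq0 k)); apply: (mulIf (qpoch_neq0 l)).
by rewrite qbin_fact -mulrA [qfac k * _]mulrC mulrA addnC qbin_fact.
Qed.

(** Both sides equal $(q)_{2M} / ((q)_s (q)_l)$ for $M = s + l$. *)
Lemma bailey_weightE s l :
  qpoch q (q ^+ (s + l).+1) (s + l) * qbin (s + l) s =
  qbin ((s + l) + (s + l)) l * qpoch q (q ^+ (s + s).+1) l * qpoch q (q ^+ s.+1) s.
Proof.
apply: (mulIf (qpoch_neq0 s)); apply: (mulIf (qpoch_neq0 l)).
transitivity (qfac (s + l) * qpoch q (q ^+ (s + l).+1) (s + l)).
  by rewrite -(qbin_fact q s l); ring.
rewrite qpoch_qfac.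
transitivity (qbin (s + l + (s + l)) l * qfac l *
  (qfac (s + s) * qpoch q (q ^+ (s + s).+1) l)); last by rewrite -(qpoch_qfac s s); ring.
by rewrite qpoch_qfac (_ : s + l + (s + l) = l + (s + s + l))%N ?qbin_fact //; lia.
Qed.

(** Both sides equal $(q)_{2M} / ((q)_l (q)_t (q)_{t+2k})$; the right one isolates
    the factor that depends on [k] and [t + l] only, which goes out of the sum
    over [t]. *)
Lemma bailey_weight_split k t l : let s := (k + t)%N in let M := (s + l)%N in
  qbin (M + M) l * qpoch q (q ^+ (s + s).+1) l * qbin (s + s) t =
  qbin (M + M) (t + l) * (qbin (t + l) t * qpoch q (q ^+ (t + k + k).+1) l).
Proof.
move=> s M; apply: (mulIf (qpoch_neq0 t)); apply: (mulIf (qpoch_neq0 l)).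
apply: (mulIf (qpoch_neq0 (t + k + k))).
transitivity (qfac (M + M)).
  transitivity (qbin (M + M) l * qfac l * (qpoch q (q ^+ (s + s).+1) l *
    (qbin (s + s) t * qfac t * qfac (t + k + k)))); first by ring.
  have E : (s + s = t + (t + k + k))%N by rewrite /s; lia.
  rewrite {2}E qbin_fact -E [qpoch _ _ l * _]mulrC qpoch_qfac.
  by rewrite (_ : M + M = l + (s + s + l))%N ?qbin_fact // /M; lia.
transitivity (qbin (M + M) (t + l) * (qbin (t + l) t * qfac t * qfac l) *
  (qfac (t + k + k) * qpoch q (q ^+ (t + k + k).+1) l)); last by ring.
rewrite qpoch_qfac qbin_fact (_ : M + M = t + l + (t + k + k + l))%N ?qbin_fact //.
by rewrite /M /s; lia.
Qed.

Lemma sum_triangle (F : nat -> nat -> R) M :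
  \sum_(s < M.+1) \sum_(k < s.+1) F s k =
  \sum_(k < M.+1) \sum_(t < (M - k).+1) F (k + t)%N k.
Proof.
elim: M => [|M IH]; first by rewrite !big_ord1.
rewrite big_ord_recr /= IH [in RHS]big_ord_recr /= subnn big_ord1 addn0.
rewrite [X in _ + X]big_ord_recr /= addrA; congr (_ + _).
rewrite -big_split /=; apply: eq_bigr => k _.
have le_k : (k <= M)%N by rewrite -ltnS.
by rewrite subSn // [RHS]big_ord_recr /= -(subSn le_k) subnKC // leqW.
Qed.

(** The Bailey lemma for $a = 1$ with both parameters sent to infinity. The
    factor [qpoch q (q ^+ n.+1) n], which is $(q)_{2n} / (q)_n$, normalises the pair so
    that a step is a plain sum against Gaussian binomials. Once the sums over [s]
    and [k] are exchanged, the inner sum is [sum_qbin_qpoch] at [a = q ^+ (2 k)]. *)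
Lemma bailey_step (alpha x : nat -> R) :
    (forall n, qpoch q (q ^+ n.+1) n * x n = bailey_sum alpha n) ->
  forall n, qpoch q (q ^+ n.+1) n * \sum_(s < n.+1) q ^+ (s ^ 2) * qbin n s * x s =
    bailey_sum (fun k => q ^+ (k ^ 2) * alpha k) n.
Proof.
move=> Hx M; rewrite mulr_sumr.
pose F s k := q ^+ (s ^ 2) * (qbin (M + M) (M - s) * qpoch q (q ^+ (s + s).+1) (M - s))
   * (alpha k * qbin (s + s) (s - k)).
transitivity (\sum_(s < M.+1) \sum_(k < s.+1) F s k).
  apply: eq_bigr => s _; have le_s : (s <= M)%N by rewrite -ltnS.
  rewrite -mulr_sumr -[X in _ = _ * X]Hx.
  have := bailey_weightE s (M - s); rewrite subnKC // => E.
  transitivity (q ^+ (s ^ 2) * (qpoch q (q ^+ M.+1) M * qbin M s) * x s); first by ring.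
  by rewrite E; ring.
rewrite sum_triangle; apply: eq_bigr => k _.
have le_k : (k <= M)%N by rewrite -ltnS.
rewrite -[RHS]mulr1 -(sum_qbin_qpoch q (M - k) (q ^+ (k + k))) mulr_sumr.
apply: eq_bigr => t _.
have le_t : (t <= M - k)%N by rewrite -ltnS.
rewrite /F addKn.
have := bailey_weight_split k t (M - k - t).
rewrite /= (_ : k + t + (M - k - t) = M)%N; last by lia.
rewrite (_ : t + (M - k - t) = M - k)%N; last by lia.
rewrite (_ : M - (k + t) = M - k - t)%N; last by lia.
rewrite -exprD (_ : k + k + t.+1 = (t + k + k).+1)%N; last by lia.
move=> E.
transitivity (q ^+ ((k + t) ^ 2) * alpha k * (qbin (M + M) (M - k - t) *
      qpoch q (q ^+ (k + t + (k + t)).+1) (M - k - t) *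
      qbin (k + t + (k + t)) t)); first by ring.
rewrite E -exprM.
have -> : q ^+ ((k + t) ^ 2) = q ^+ (k ^ 2) * q ^+ (t ^ 2) * q ^+ ((k + k) * t).
  by rewrite -!exprD; congr (q ^+ _); rewrite -!mulnn; lia.
by ring.
Qed.

Lemma binS2 k : 'C(k.+1, 2) = ('C(k, 2) + k)%N.
Proof. by rewrite binS bin1. Qed.

Lemma qbinomial_theorem x y n : \prod_(i < n) (y + x * q ^+ i) =
  \sum_(j < n.+1) q ^+ 'C(j, 2) * qbin n j * x ^+ j * y ^+ (n - j).
Proof.
elim: n => [|n IH]; first by rewrite big_ord0 big_ord1 qbin0 bin0n; ring.
rewrite big_ord_recr /= IH [RHS]big_ord_recl.
under [in RHS]eq_bigr => i _ do rewrite lift0 qbinSr -1?ltnS // mulrDr !mulrDl.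
rewrite big_split /= [in RHS]addrCA mulrDr addrC; congr (_ + _).
  rewrite [in RHS]big_ord_recr /= [qbin n n.+1]qbin_small // mulr0 !mul0r addr0.
  rewrite mulr_suml big_ord_recl; congr (_ + _).
    by rewrite !qbin0 !subn0 exprS; ring.
  apply: eq_bigr => i _; rewrite lift0 subSS -(subnSK (ltn_ord i)) !exprS.
  by ring.
rewrite mulr_suml; apply: eq_bigr => i _; rewrite binS2 subSS.
have -> : q ^+ n = q ^+ (n - i) * q ^+ i by rewrite -exprD subnK // -ltnS.
by rewrite exprD exprS; ring.
Qed.

Lemma bin2D m n : 'C(m + n, 2) = ('C(m, 2) + 'C(n, 2) + m * n)%N.
Proof. elim: n => [|n IH]; first by rewrite !addn0 muln0 addn0.
by rewrite addnS !binS2 IH mulnS; lia. Qed.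

Lemma bin2_double n : ('C(n, 2) + 'C(n, 2) + n = n * n)%N.
Proof. by elim: n => [|n IH] //; rewrite binS2; lia. Qed.

Lemma prodr_scale n (c : R) (F : 'I_n -> R) :
  \prod_(i < n) (c * F i) = c ^+ n * \prod_(i < n) F i.
Proof. by rewrite big_split prodr_const card_ord. Qed.

(** From $q^n - a q^i = -a q^i (1 - b q^{n-i-1})$ for $a b = q$: this half of
    the q-binomial product turns into the factor of the triple product in [b]. *)
Lemma qpoch_reverse a b n : a * b = q ->
  \prod_(i < n) (q ^+ n + - a * q ^+ i) = q ^+ 'C(n, 2) * (- a) ^+ n * qpoch q b n.
Proof.
move=> ab; elim: n => [|n IH].
  by rewrite big_ord0 qpoch0 bin0n; ring.
rewrite big_ord_recl.
have -> : \prod_(i < n) (q ^+ n.+1 + - a * q ^+ lift ord0 i) =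
    q ^+ n * \prod_(i < n) (q ^+ n + - a * q ^+ i).
  rewrite -prodr_scale; apply: eq_bigr => i _; rewrite lift0 !exprS; ring.
by rewrite IH qpochS binS2 exprD !exprS -{1}ab /=; ring.
Qed.

(** The q-binomial theorem for $2n$ factors $q^n - a q^i$: the first $n$ of them
    give the product in [b], the last $n$ the product in [a], and the terms of
    index $n + k$ and $n - k$ give the two halves of [jacobi_coef], all up to the
    common factor [K]. *)
Lemma jacobi_finite a b n : a * b = q -> q != 0 ->
  qpoch q a n * qpoch q b n = bailey_sum (jacobi_coef a b) n.
Proof.
move=> ab q0.
have a0 : a != 0 by apply: contraNneq q0 => a0; rewrite -ab a0 mul0r.
pose K := q ^+ ('C(n, 2) + n * n) * (- a) ^+ n.
have K0 : K != 0 by rewrite mulf_neq0 ?expf_neq0 // oppr_eq0.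
apply: (mulfI K0).
transitivity (\prod_(i < n + n) (q ^+ n + - a * q ^+ i)).
  rewrite big_split_ord /= (qpoch_reverse n ab).
  have -> : \prod_(i < n) (q ^+ n + - a * q ^+ (n + i)) = q ^+ (n * n) * qpoch q a n.
    by rewrite exprM -prodr_scale; apply: eq_bigr => i _; rewrite exprD; ring.
  by rewrite /K exprD; ring.
pose T j := q ^+ 'C(j, 2) * qbin (n + n) j * (- a) ^+ j * q ^+ n ^+ (n + n - j).
have Thi k : (k <= n)%N -> T (n + k)%N =
    K * ((- a) ^+ k * q ^+ 'C(k, 2) * qbin (n + n) (n - k)).
  move=> le_k; have E : (n + n = n + k + (n - k))%N by lia.
  rewrite /T /K -exprM bin2D {1}E qbin_sym -E (_ : n + n - (n + k) = n - k)%N; last lia.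
  have -> : q ^+ ('C(n, 2) + n * n) = q ^+ 'C(n, 2) * q ^+ (n * k) * q ^+ (n * (n - k)).
    by rewrite -!exprD; congr (q ^+ _); nia.
  by rewrite !exprD; ring.
have Tlo k : (k <= n)%N -> T (n - k)%N =
    K * ((- b) ^+ k * q ^+ 'C(k, 2) * qbin (n + n) (n - k)).
  move=> le_k; rewrite /T /K -exprM.
  have -> : (- a) ^+ n = (- a) ^+ (n - k) * (- a) ^+ k by rewrite -exprD subnK.
  have E : q ^+ 'C(n - k, 2) * q ^+ (n * (n + n - (n - k))) =
      q ^+ ('C(n, 2) + n * n) * q ^+ 'C(k, 2) * ((- a) ^+ k * (- b) ^+ k).
    rewrite -exprMn mulrNN ab -!exprD; congr (q ^+ _).
    have := bin2_double k; have := bin2D (n - k) k; rewrite subnK //; nia.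
  transitivity (q ^+ 'C(n - k, 2) * q ^+ (n * (n + n - (n - k))) *
    (- a) ^+ (n - k) * qbin (n + n) (n - k)); first by ring.
  by rewrite E; ring.
rewrite qbinomial_theorem -addnS big_split_ord /=.
rewrite (eq_bigr (fun i : 'I_n => T i)) //.
rewrite [X in _ + X](eq_bigr (fun i : 'I_n.+1 => T (n + i)%N)) //.
rewrite [X in _ + X]big_ord_recl /bailey_sum [in RHS]big_ord_recl mulrDr addrCA.
congr (_ + _).
  by rewrite (Thi 0) // !subn0 bin0n /=; ring.
rewrite (reindex_inj rev_ord_inj) /= -big_split mulr_sumr; apply: eq_bigr => i _ /=.
rewrite /bump leq0n add1n (Thi i.+1) ?(Tlo i.+1) //.
by rewrite -[- a]mulN1r -[- b]mulN1r !exprMn; ring.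
Qed.

End Bailey.

(** * Congruences modulo a power of q *)

Section Congruence.
Variables (R : comNzRingType) (t : R).

Definition eqmod (f g : R) : Prop := exists h, f = g + t * h.

Lemma eqmod_refl f : eqmod f f.
Proof. by exists 0; ring. Qed.

Lemma eqmod_sym f g : eqmod f g -> eqmod g f.
Proof. by case=> h ->; exists (- h); ring. Qed.

Lemma eqmod_trans g f k : eqmod f g -> eqmod g k -> eqmod f k.
Proof. by case=> h -> [h' ->]; exists (h + h'); ring. Qed.

Lemma eqmodM f g f' g' : eqmod f g -> eqmod f' g' -> eqmod (f * f') (g * g').
Proof. by case=> h -> [h' ->]; exists (h * g' + g * h' + t * h * h'); ring. Qed.

Lemma eqmodD f g f' g' : eqmod f g -> eqmod f' g' -> eqmod (f + f') (g + g').
Proof. by case=> h -> [h' ->]; exists (h + h'); ring. Qed.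

Lemma eqmodN f g : eqmod f g -> eqmod (- f) (- g).
Proof. by case=> h ->; exists (- h); ring. Qed.

Lemma eqmodMl c f g : eqmod f g -> eqmod (c * f) (c * g).
Proof. exact/eqmodM/eqmod_refl. Qed.

Lemma eqmodMr c f g : eqmod f g -> eqmod (f * c) (g * c).
Proof. by move/eqmodM; apply; apply: eqmod_refl. Qed.

Lemma eqmod_sum I (r : seq I) (P : pred I) (F G : I -> R) :
  (forall i, P i -> eqmod (F i) (G i)) ->
  eqmod (\sum_(i <- r | P i) F i) (\sum_(i <- r | P i) G i).
Proof.
move=> FG; elim/big_rec2: _ => [|i x y /FG]; first exact: eqmod_refl.
exact: eqmodD.
Qed.

Definition invmod (f : R) : Prop := exists g, eqmod (g * f) 1.

Lemma invmod1 : invmod 1.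
Proof. by exists 1; rewrite mulr1; apply: eqmod_refl. Qed.

Lemma invmodM f g : invmod f -> invmod g -> invmod (f * g).
Proof.
case=> f' Hf [g' Hg]; exists (g' * f').
rewrite (_ : _ * _ = (f' * f) * (g' * g)); last by ring.
by rewrite -[1]mulr1; apply: eqmodM.
Qed.

Lemma eqmod_cancel f a b : invmod f -> eqmod (f * a) (f * b) -> eqmod a b.
Proof.
case=> g Hg ab; apply: (@eqmod_trans (g * f * a)).
  by rewrite -[X in eqmod X]mul1r; apply/eqmodMr/eqmod_sym.
apply: (@eqmod_trans (g * f * b)); first by rewrite -!mulrA; apply: eqmodMl.
by rewrite -[X in eqmod _ X]mul1r; apply: eqmodMr.
Qed.

End Congruence.

Section Limit.
Variables (R : comNzRingType) (q : R).

Lemma eqmod_scale (s t f g : R) : eqmod t f g -> eqmod (s * t) (s * f) (s * g).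
Proof. by case=> h ->; exists h; ring. Qed.

Lemma eqmod_exp_le (m n : nat) (f g : R) : (m <= n)%N ->
  eqmod (q ^+ n) f g -> eqmod (q ^+ m) f g.
Proof.
move=> le_mn [h ->]; exists (q ^+ (n - m) * h).
by rewrite mulrA -exprD subnKC.
Qed.

Lemma eqmod0_exp m n c : (m <= n)%N -> eqmod (q ^+ m) (q ^+ n * c) 0.
Proof.
by move=> le_mn; exists (q ^+ (n - m) * c); rewrite add0r mulrA -exprD subnKC.
Qed.

Lemma qpoch_eqmod1 p a m n c : a = q ^+ m * c -> eqmod (q ^+ m) (qpoch p a n) 1.
Proof.
move=> ->; elim: n => [|n IH]; first by rewrite qpoch0; apply: eqmod_refl.
rewrite qpochS -[1]mulr1; apply: eqmodM => //.
by exists (- c * p ^+ n); ring.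
Qed.

Lemma invmod_sub1 m z c : z = q * c -> invmod (q ^+ m) (1 - z).
Proof.
move=> zE; exists (\sum_(i < m) z ^+ i); rewrite mulrC -opprB mulNr -subrX1 opprB.
by exists (- c ^+ m); rewrite zE exprMn; ring.
Qed.

Lemma invmod_qpoch m p a n c : a = q * c -> invmod (q ^+ m) (qpoch p a n).
Proof.
move=> aE; elim: n => [|n IH]; first by rewrite qpoch0; apply: invmod1.
rewrite qpochS; apply: invmodM => //; apply: (@invmod_sub1 _ _ (c * p ^+ n)).
by rewrite aE mulrA.
Qed.

(** The limit of a cleared Bailey pair: $(p)_n [2n, n-k]$ is 1 up to
    $O(q^{n-k+1})$, and the divisibility of [alpha k] by $q^k$ makes up for the
    missing $k$. The base [p] is a multiple of [q] because both $q$ and $q^7$ are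
    needed. *)
Lemma bailey_limit p c (alpha : nat -> R) n : p = q * c ->
    (forall k, exists d, alpha k = q ^+ k * d) ->
  eqmod (q ^+ n.+1) (qpoch p p n * bailey_sum p alpha n) (\sum_(k < n.+1) alpha k).
Proof.
move=> pE alphaE; rewrite /bailey_sum mulr_sumr; apply: eqmod_sum => k _.
have le_k : (k <= n)%N by rewrite -ltnS.
have [d ->] := alphaE k.
have -> : qpoch p p n * (q ^+ k * d * qbin p (n + n) (n - k)) =
    q ^+ k * (d * (qpoch p (p ^+ (n + k).+1) (n - k) * qpoch p (p ^+ (n - k).+1) k)).
  rewrite -qbin_qpoch (_ : n - k + (n + k) = n + n)%N; last by lia.
  have -> : qpoch p p n = qpoch p p (n - k) * qpoch p (p ^+ (n - k).+1) k.
    by rewrite exprS -qpochD subnK.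
  by ring.
have -> : q ^+ n.+1 = q ^+ k * q ^+ (n - k).+1 by rewrite -exprD; congr (q ^+ _); lia.
apply: eqmod_scale; rewrite -[X in eqmod _ _ X]mulr1; apply: eqmodMl.
rewrite -[1]mulr1; apply: eqmodM; last first.
  by apply: (@qpoch_eqmod1 _ _ _ _ (c ^+ (n - k).+1)); rewrite pE exprMn.
apply: (@eqmod_exp_le _ (n + k).+1); first by lia.
by apply: (@qpoch_eqmod1 _ _ _ _ (c ^+ (n + k).+1)); rewrite pE exprMn.
Qed.

End Limit.

(** * The Andrews-Gordon product modulo 7 *)

Local Notation q := ('X : {poly int}).

Lemma qpoch_polyX_neq0 k n : (0 < k)%N -> qpoch (q ^+ k) (q ^+ k) n != 0.
Proof.
move=> k0; apply: contraNneq (oner_neq0 int) => E0.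
rewrite -(horner0 0) -E0 horner_prod big1 // => i _.
by rewrite !hornerE /= expr0n eqn0Ngt k0 mul0r subr0.
Qed.

(** Three Bailey steps contribute $q^{3 k^2}$, and
    $3 k^2 + k (k - 1) / 2 = 7 k (k - 1) / 2 + 3 k$. This is where the modulus 7
    and the residues 3 and 4 come from. *)
Lemma jacobi_coef_dissect k :
  q ^+ (k ^ 2) * (q ^+ (k ^ 2) * (q ^+ (k ^ 2) * jacobi_coef q 1 q k)) =
  jacobi_coef (q ^+ 7) (q ^+ 3) (q ^+ 4) k.
Proof.
case: k => [|k]; first by rewrite /=; ring.
rewrite /jacobi_coef expr1n -!exprM; set m := k.+1.
have E c : q ^+ (m ^ 2) * (q ^+ (m ^ 2) * (q ^+ (m ^ 2) * (q ^+ 'C(m, 2) * c))) =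
    q ^+ (7 * 'C(m, 2)) * q ^+ (3 * m) * c.
  rewrite !mulrA -!exprD; congr (q ^+ _ * _).
  by have := bin2_double m; rewrite -mulnn; lia.
transitivity ((-1) ^+ m * (q ^+ (m ^ 2) * (q ^+ (m ^ 2) * (q ^+ (m ^ 2) *
  (q ^+ 'C(m, 2) * (1 + q ^+ m)))))); first by ring.
by rewrite E (_ : 4 * m = 3 * m + m)%N ?exprD; [ring | lia].
Qed.

(** The Bailey chain. The triple product at $(1, q)$ has a factor $1 - 1$, so the
    chain starts from $\delta_{n,0}$; it continues with 1 and [rrpoly q 0] before
    it reaches the sum on the left. *)
Lemma andrews_gordon_finite n :
  qpoch q (q ^+ n.+1) n * \sum_(s < n.+1) q ^+ (s ^ 2) * qbin q n s * rrpoly q 0 s =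
  bailey_sum q (jacobi_coef (q ^+ 7) (q ^+ 3) (q ^+ 4)) n.
Proof.
have q1 : q = q ^+ 1 by [].
have nz m : qpoch q q m != 0 by rewrite q1; apply: qpoch_polyX_neq0.
have step0 m : qpoch q (q ^+ m.+1) m * (m == 0)%:R = bailey_sum q (jacobi_coef q 1 q) m.
  rewrite -jacobi_finite ?mul1r ?polyX_eq0 //.
  by case: m => [|m]; rewrite ?qpoch0 ?mulr1 // mulr0 qpochSl subrr !mul0r.
have step3 := bailey_step nz (bailey_step nz (bailey_step nz step0)) n.
transitivity (bailey_sum q (fun k => q ^+ (k ^ 2) * (q ^+ (k ^ 2) *
    (q ^+ (k ^ 2) * jacobi_coef q 1 q k))) n); last first.
  by apply: eq_bigr => k _; rewrite jacobi_coef_dissect.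
rewrite -[RHS]step3; congr (_ * _); apply: eq_bigr => s _; congr (_ * _).
apply: eq_bigr => j _; rewrite addn0 -[LHS]mulr1; congr (_ * _).
rewrite big_ord_recl big1 => [|i _]; last by rewrite lift0 mulr0.
by rewrite qbin0 /=; ring.
Qed.

(** The finite identity and the finite triple product in base $q^7$ have the same
    coefficients, hence the same limit. *)
Lemma andrews_gordon_mod n :
  eqmod (q ^+ n.+1) (qpoch q q n * \sum_(s < n.+1) q ^+ (s ^ 2) * qbin q n s * rrpoly q 0 s)
   (qpoch (q ^+ 7) (q ^+ 3) n * qpoch (q ^+ 7) (q ^+ 4) n * qpoch (q ^+ 7) (q ^+ 7) n).
Proof.
have coefE k : exists d, jacobi_coef (q ^+ 7) (q ^+ 3) (q ^+ 4) k = q ^+ k * d.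
  case: k => [|k]; first by exists 1; rewrite /=; ring.
  exists ((-1) ^+ k.+1 * q ^+ 7 ^+ 'C(k.+1, 2) * (q ^+ k.+1 ^+ 2 + q ^+ k.+1 ^+ 3)).
  rewrite /jacobi_coef -[q ^+ 3 ^+ _]exprM -[q ^+ 4 ^+ _]exprM.
  by rewrite ![(_ * k.+1)%N]mulnC !exprM; ring.
set S := \sum_(s < _) _.
apply: (@eqmod_trans _ _ (qpoch q q n * (qpoch q (q ^+ n.+1) n * S))).
  rewrite mulrCA -[X in eqmod _ X]mul1r; apply: eqmodMr; apply: eqmod_sym.
  by apply: (@qpoch_eqmod1 _ _ _ _ _ _ 1); rewrite mulr1.
rewrite andrews_gordon_finite.
apply: (@eqmod_trans _ _ (\sum_(k < n.+1) jacobi_coef (q ^+ 7) (q ^+ 3) (q ^+ 4) k)).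
  by apply: (@bailey_limit _ _ _ 1); rewrite ?mulr1.
rewrite jacobi_finite ?expf_neq0 ?polyX_eq0 -?exprD //; last first.
  by move=> m; apply: qpoch_polyX_neq0.
rewrite mulrC; apply: eqmod_sym.
by apply: (@bailey_limit _ _ _ (q ^+ 6)); rewrite -?exprS.
Qed.

(** * Generating function of the marked partitions *)

Definition marked_gf (n : nat) (e : bool) (N c : nat) : {poly int} :=
  \sum_(s <- gapped n N c) (marks e c s)%:R * q ^+ sumn s.

Lemma marked_gfS n e N c : marked_gf n e N.+1 c =
  \sum_(c.+1 <= x < n.+1) q ^+ x *
    ((compat e false (x.+1 - c))%:R * marked_gf n false N x.+1 +
     (compat e true (x.+1 - c))%:R * marked_gf n true N x.+1).
Proof.
rewrite /marked_gf /= big_allpairs_dep /=; apply: eq_bigr => x _.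
rewrite !mulr_sumr -big_split mulr_sumr; apply: eq_bigr => s _ /=.
by rewrite natrD !natrM exprD; ring.
Qed.

Section Geometric.
Variables (n c N : nat).
Local Notation z := (q ^+ N.+1).

Lemma geom_small_mod i : (n < i)%N -> eqmod (q ^+ n.+1) (z ^+ i) 0.
Proof.
by move=> lt_ni; rewrite -exprM -[X in eqmod _ X]mulr1; apply: eqmod0_exp; lia.
Qed.

Lemma geom_mod :
  eqmod (q ^+ n.+1) ((1 - z) * \sum_(c.+1 <= x < n.+1) z ^+ x) (z ^+ c.+1).
Proof.
have [le_cn|lt_nc] := leqP c n; last first.
  by rewrite big_geq ?mulr0 //; [apply/eqmod_sym/geom_small_mod; lia | lia].
rewrite mulr_sumr (eq_bigr (fun x => - (z ^+ x.+1 - z ^+ x))); last first.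
  by move=> x _; rewrite [_ ^+ x.+1]exprS; ring.
rewrite sumrN telescope_sumr // opprB.
rewrite -[X in eqmod _ _ X]subr0; apply: eqmodD; first exact: eqmod_refl.
by apply/eqmodN/geom_small_mod.
Qed.

(** Omitting one distance from a geometric progression; when [d] lies beyond the
    cutoff nothing is omitted, but then [z ^+ d] vanishes as well. *)
Lemma geom_skip_mod d : (c < d)%N ->
  eqmod (q ^+ n.+1) ((1 - z) * \sum_(c.+1 <= x < n.+1) (x != d)%:R * z ^+ x)
    (z ^+ c.+1 - (1 - z) * z ^+ d).
Proof.
move=> lt_cd; have [lt_nd|le_dn] := ltnP n d.
  rewrite (eq_big_nat _ _ (F2 := fun x => z ^+ x)) => [|x x_in]; last first.
    by rewrite (_ : x != d) ?mul1r //; lia.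
  rewrite -[X in eqmod _ X]subr0; apply: eqmodD; first exact: geom_mod.
  apply: eqmodN; rewrite -(mulr0 (1 - z)).
  exact/eqmod_sym/eqmodMl/geom_small_mod.
have d_in : d \in index_iota c.+1 n.+1 by rewrite mem_index_iota; lia.
have -> : \sum_(c.+1 <= x < n.+1) (x != d)%:R * z ^+ x =
    \sum_(c.+1 <= x < n.+1) z ^+ x - z ^+ d.
  rewrite (bigD1_seq d) ?iota_uniq //= [in RHS](bigD1_seq d) ?iota_uniq //=.
  rewrite eqxx mul0r add0r [X in _ = X - _]addrC addrK.
  by apply: eq_bigr => x ->; rewrite mul1r.
by rewrite mulrBr; apply: eqmodD; [exact: geom_mod | exact: eqmod_refl].
Qed.

(** The entries of the transfer matrix, each over the common denominator [1 - z]. *)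
Lemma geom_compat_mod e e' :
  eqmod (q ^+ n.+1)
    ((1 - z) * \sum_(c.+1 <= x < n.+1) (compat e e' (x.+1 - c))%:R * z ^+ x)
    (z ^+ c.+1 * (if e && e' then 1 - z + z ^+ 2 else if e || e' then z else 1)).
Proof.
have compat2 x : (c.+1 <= x < n.+1)%N -> (x.+1 - c == 2)%N = (x == c.+1) by lia.
have compat3 x : (c.+1 <= x < n.+1)%N -> (x.+1 - c == 3)%N = (x == c.+2) by lia.
rewrite (eq_big_nat _ _ (F2 := fun x => (if e == e' then ~~ [&& e, e' & x == c.+2]
    else x != c.+1)%:R * z ^+ x)); last first.
  move=> x x_in; rewrite /compat compat2 // compat3 //; congr (_%:R * _).
  by case: e; case: e'; case: (x =P c.+1) => E1; case: (x =P c.+2) => E2 //=; lia.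
move: e e' => [] [] /=.
- rewrite [X in eqmod _ _ X](_ : _ = z ^+ c.+1 - (1 - z) * z ^+ c.+2); last first.
    by rewrite !exprS; ring.
  exact: geom_skip_mod.
- rewrite [X in eqmod _ _ X](_ : _ = z ^+ c.+1 - (1 - z) * z ^+ c.+1); last by ring.
  exact: geom_skip_mod.
- rewrite [X in eqmod _ _ X](_ : _ = z ^+ c.+1 - (1 - z) * z ^+ c.+1); last by ring.
  exact: geom_skip_mod.
rewrite mulr1 (eq_bigr (fun x => z ^+ x)) => [|x _]; first exact: geom_mod.
by rewrite mul1r.
Qed.

End Geometric.

(** Induction on the number of parts. A smallest part [x] followed by [N] parts
    contributes [q ^+ x] and raises the start of the others to [x.+1], hence
    [q ^+ (N * x.+1)] by induction: in all a geometric progression in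
    [z = q ^+ N.+1], restricted by [compat], for each mark of [x]. The outcome is
    the pair of recurrences of [rrpoly]. *)
Lemma marked_gf_mod n e N c : eqmod (q ^+ n.+1)
  (qpoch q q N * marked_gf n e N c) (q ^+ (N ^ 2 + N * c) * rrpoly q e N).
Proof.
elim: N e c => [|N IH] e c.
  rewrite /marked_gf big_seq1 qpoch0 /rrpoly big_ord1 qbin0 /= muln0 mul0n expr0.
  by rewrite mul1r !mulr1; apply: eqmod_refl.
rewrite qpochS -exprS marked_gfS; set z := q ^+ N.+1.
pose K e' := \sum_(c.+1 <= x < n.+1) (compat e e' (x.+1 - c))%:R * z ^+ x.
apply: (@eqmod_trans _ _ ((1 - z) * (q ^+ (N ^ 2 + N) *
    (K false * rrpoly q 0 N + K true * rrpoly q 1 N)))).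
  rewrite [qpoch q q N * _]mulrC -mulrA; apply: eqmodMl.
  rewrite /K !mulr_suml -big_split !mulr_sumr; apply: eqmod_sum => x _ /=.
  set k0 := (compat _ _ _)%:R; set k1 := (compat _ _ _)%:R.
  rewrite (_ : qpoch q q N * _ = q ^+ x * (k0 * (qpoch q q N * marked_gf n false N x.+1)
     + k1 * (qpoch q q N * marked_gf n true N x.+1))); last by ring.
  rewrite (_ : q ^+ (N ^ 2 + N) * _ = q ^+ x * (k0 * (q ^+ (N ^ 2 + N * x.+1) * rrpoly q 0 N)
     + k1 * (q ^+ (N ^ 2 + N * x.+1) * rrpoly q 1 N))).
    by apply/eqmodMl/eqmodD; apply: eqmodMl; apply: IH.
  by rewrite /z -exprM mulnS mulSn !exprD; ring.
have -> : q ^+ (N.+1 ^ 2 + N.+1 * c) = q ^+ (N ^ 2 + N) * z ^+ c.+1.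
  by rewrite -exprM -exprD; congr (q ^+ _); rewrite -!mulnn; lia.
rewrite mulrCA -mulrA; apply: eqmodMl; rewrite mulrDr !mulrA.
apply: (@eqmod_trans _ _ (z ^+ c.+1 * (if e then z else 1) * rrpoly q 0 N +
   z ^+ c.+1 * (if e then 1 - z + z ^+ 2 else z) * rrpoly q 1 N)).
  apply: eqmodD; apply: eqmodMr; rewrite /K {K}.
    by have := geom_compat_mod n c N e false; rewrite andbF orbF; case: e.
  by have := geom_compat_mod n c N e true; rewrite andbT orbT; case: e.
rewrite (_ : _ + _ = z ^+ c.+1 * rrpoly q e N.+1); first exact: eqmod_refl.
by case: e @K => _; rewrite ?rrpoly1S ?rrpoly0S -/z; ring.
Qed.

(** Here $1 / (q)_N$ is replaced by [qbin q n N], from which it differs by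
    $O(q^{n-N+1})$; the factor $q^{N^2}$ in front gains at least $q^N$. *)
Lemma R_gf_mod n : eqmod (q ^+ n.+1)
  (qpoch q q n * \sum_(N < n.+1) marked_gf n false N 0)
  (qpoch q q n * \sum_(N < n.+1) q ^+ (N ^ 2) * qbin q n N * rrpoly q 0 N).
Proof.
rewrite !mulr_sumr; apply: eqmod_sum => N _.
have le_N : (N <= n)%N by rewrite -ltnS.
apply: eqmodMl; apply: (@eqmod_cancel _ _ (qpoch q q N)).
  by apply: (@invmod_qpoch _ _ _ _ _ _ 1); rewrite mulr1.
apply: eqmod_trans (marked_gf_mod _ _ _ _) _; rewrite muln0 addn0.
rewrite (_ : qpoch q q N * _ = q ^+ N * (q ^+ (N ^ 2 - N) * rrpoly q 0 N *
   (qbin q n N * qpoch q q N))); last first.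
  have -> : q ^+ (N ^ 2) = q ^+ N * q ^+ (N ^ 2 - N).
    by rewrite -exprD subnKC // -mulnn; nia.
  ring.
rewrite (_ : q ^+ (N ^ 2) * _ = q ^+ N * (q ^+ (N ^ 2 - N) * rrpoly q 0 N * 1)); last first.
  have -> : q ^+ (N ^ 2) = q ^+ N * q ^+ (N ^ 2 - N).
    by rewrite -exprD subnKC // -mulnn; nia.
  ring.
rewrite (_ : q ^+ n.+1 = q ^+ N * q ^+ (n - N).+1); last first.
  by rewrite -exprD; congr (q ^+ _); lia.
apply: eqmod_scale; apply: eqmodMl; apply: eqmod_sym.
have := qbin_qpoch q N (n - N); rewrite subnKC // => ->.
by apply: (@qpoch_eqmod1 _ _ _ _ _ _ 1); rewrite mulr1.
Qed.

(** * Coefficients and sums over partitions *)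

Definition seq_gf (L : seq (seq nat)) (w : seq nat -> nat) : {poly int} :=
  \sum_(s <- L) (w s)%:R * q ^+ sumn s.

Lemma coef_seq_gf L w m :
  (seq_gf L w)`_m = (\sum_(s <- L | sumn s == m) w s)%N%:R.
Proof.
rewrite /seq_gf coef_sum natr_sum [RHS]big_mkcond; apply: eq_bigr => s _.
by rewrite mulr_natl coefMn coefXn eq_sym; case: eqP; rewrite ?mul0rn.
Qed.

Lemma eqmod_coef (n : nat) (f g : {poly int}) : eqmod (q ^+ n.+1) f g -> f`_n = g`_n.
Proof. by case=> h ->; rewrite coefD coefXnM ltnSn addr0. Qed.

(** Replaces the type of partitions of [n] by any explicit duplicate-free list
    with the same members of sum [n]. *)
Lemma sum_intpart n (P : pred (seq nat)) (F : seq nat -> nat) (L : seq (seq nat)) :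
    uniq L ->
    (forall s, (s \in L) && (sumn s == n) = is_part_of n s && P s) ->
  (\sum_(p : intpart n | P p) F p = \sum_(s <- L | sumn s == n) F s)%N.
Proof.
move=> uL memL.
rewrite -[RHS]big_filter -(big_map (@parts n) P F) -[LHS]big_filter.
apply: perm_big; apply: uniq_perm; rewrite ?filter_uniq ?map_inj_uniq //.
- exact: index_enum_uniq.
- exact: val_inj.
move=> s; rewrite !mem_filter [RHS]andbC memL andbC; congr (_ && _).
apply/mapP/idP => [[p _ ->]|s_part]; first exact: partsP.
by exists (IntPart s_part); rewrite ?mem_index_enum.
Qed.

Lemma size_le_sumn s : 0%N \notin s -> (size s <= sumn s)%N.
Proof.
elim: s => //= x s IH; rewrite inE negb_or => /andP[x0 /IH].
by move: x0; rewrite eq_sym -lt0n; lia.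
Qed.

Lemma mem_le_sumn x s : x \in s -> (x <= sumn s)%N.
Proof. by elim: s => //= y s IH; rewrite inE => /predU1P[->|/IH]; lia. Qed.

(** * Generating function of the partitions into allowed parts *)

(** Partitions with parts in the decreasing list [r], each used at most [n]
    times; the bound is harmless for partitions of numbers up to [n]. *)
Fixpoint bounded_parts (n : nat) (r : seq nat) : seq (seq nat) :=
  if r is a :: r' then
    [seq nseq j a ++ s | j <- iota 0 n.+1, s <- bounded_parts n r']
  else [:: [::]].

Lemma bounded_parts_cons n a r : bounded_parts n (a :: r) =
  [seq nseq j a ++ s | j <- iota 0 n.+1, s <- bounded_parts n r].
Proof. by []. Qed.

Lemma bounded_parts_sound n r s : sorted gtn r -> s \in bounded_parts n r ->
  sorted geq s && all [in r] s.
Proof.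
elim: r s => [|a r IH] s; first by rewrite inE => _ /eqP ->.
rewrite bounded_parts_cons => r_sorted; case/allpairsP=> [[j t] /= [_ t_in ->]].
have [t_sorted /allP t_r] := andP (IH t (path_sorted r_sorted) t_in).
have a_gt x : x \in t -> (x <= a)%N.
  move=> /t_r x_r; apply: ltnW.
  by have /allP := order_path_min (fun x y z yx zy => ltn_trans zy yx) r_sorted; apply.
rewrite all_cat all_nseq mem_head orbT /= andbC; apply/andP; split.
  by apply/allP => x /t_r; rewrite inE => ->; rewrite orbT.
elim: j => [//|j] /=; case: j => [|j] /=; last by rewrite /geq /= leqnn.
by case: t a_gt t_sorted {t_in t_r} => [//|x t] a_gt /= ->; rewrite a_gt ?mem_head.
Qed.

Lemma bounded_parts_complete n r s : sorted gtn r -> sorted geq s -> all [in r] s ->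
  (size s <= n)%N -> s \in bounded_parts n r.
Proof.
elim: r s => [|a r IH] s; first by case: s.
move=> r_sorted s_sorted s_r s_n; rewrite bounded_parts_cons.
suff [j [t [E t_r]]] : exists j t, s = nseq j a ++ t /\ all [in r] t.
  rewrite E; apply/allpairsP; exists (j, t); split=> //.
    by rewrite mem_iota /=; move: s_n; rewrite E size_cat size_nseq; lia.
  apply: IH => //; first exact: path_sorted r_sorted.
    by move: s_sorted; rewrite E => /cat_sorted2[].
  by move: s_n; rewrite E size_cat /=; lia.
elim: s s_sorted s_r {s_n} => [|x s IHs]; first by exists 0, [::].
move=> /= s_sorted /andP[x_r s_r].
have [xa|xa] := eqVneq x a.
  have [j [t [E t_r]]] := IHs (path_sorted s_sorted) s_r.
  by exists j.+1, t; rewrite E xa.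
exists 0, (x :: s); split=> //=.
have x_in : x \in r by move: x_r; rewrite inE (negbTE xa).
have lt_xa : (x < a)%N.
  by have /allP := order_path_min (fun x y z yx zy => ltn_trans zy yx) r_sorted; apply.
rewrite x_in /=; apply/allP => y y_s.
have := allP s_r y y_s; rewrite inE => /predU1P[ya|//].
have /allP/(_ y y_s) := order_path_min (fun x y z yx zy => leq_trans zy yx) s_sorted.
by rewrite /geq /= ya leqNgt lt_xa.
Qed.

Lemma bounded_parts_uniq n r : sorted gtn r -> uniq (bounded_parts n r).
Proof.
elim: r => [//|a r IH] r_sorted; have r_s := path_sorted r_sorted.
have notin t : t \in bounded_parts n r -> count_mem a t = 0%N.
  move=> /(bounded_parts_sound r_s)/andP[_ /allP t_r].
  apply/eqP; rewrite -leqn0 leqNgt -has_count; apply/negP => /hasP[x /t_r x_r /eqP xa].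
  have /allP/(_ x x_r) := order_path_min (fun x y z yx zy => ltn_trans zy yx) r_sorted.
  by rewrite /= xa ltnn.
rewrite bounded_parts_cons; apply: allpairs_uniq; [exact: iota_uniq | exact: IH | ].
move=> u v; case/allpairsPdep=> [j [s [_ s_in ->]]].
case/allpairsPdep=> [k [t [_ t_in ->]]] /= E.
have := congr1 (count_mem a) E; rewrite !count_cat !count_nseq /= eqxx !mul1n !notin //.
rewrite !addn0 => jk; rewrite jk in E *.
by congr (_, _); have := congr1 (drop k) E; rewrite !drop_size_cat ?size_nseq.
Qed.

Lemma bounded_parts_gf n r : 0%N \notin r ->
  eqmod (q ^+ n.+1) (\prod_(a <- r) (1 - q ^+ a) * seq_gf (bounded_parts n r) (fun=> 1%N)) 1.
Proof.
elim: r => [|a r IH].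
  by rewrite /seq_gf big_nil big_seq1 !mul1r expr0 => _; apply: eqmod_refl.
rewrite inE negb_or => /andP[a0 /IH{}IH].
have -> : seq_gf (bounded_parts n (a :: r)) (fun=> 1%N) =
    (\sum_(j < n.+1) (q ^+ a) ^+ j) * seq_gf (bounded_parts n r) (fun=> 1%N).
  rewrite /seq_gf bounded_parts_cons big_allpairs_dep.
  rewrite -(big_mkord xpredT (fun j => (q ^+ a) ^+ j)) /index_iota subn0 mulr_suml.
  apply: eq_bigr => j _; rewrite mulr_sumr; apply: eq_bigr => s _.
  by rewrite sumn_cat sumn_nseq exprD exprM !mul1r.
rewrite big_cons -[X in eqmod _ _ X]mulr1.
rewrite (_ : _ * _ * _ = ((1 - q ^+ a) * \sum_(j < n.+1) (q ^+ a) ^+ j) *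
   (\prod_(a <- r) (1 - q ^+ a) * seq_gf (bounded_parts n r) (fun=> 1%N))); last by ring.
apply: eqmodM => //; rewrite -opprB mulNr -subrX1 opprB.
exists (- (q ^+ a.-1) ^+ n.+1).
have -> : q ^+ a = q * q ^+ a.-1 by rewrite -exprS prednK // lt0n eq_sym.
by rewrite exprMn; ring.
Qed.

Definition allowed (i : nat) : bool :=
  [&& i != 0 %[mod 7], i != 3 %[mod 7] & i != 4 %[mod 7]].

Lemma allowed_addMl n i : allowed (7 * n + i) = allowed i.
Proof. by rewrite /allowed mulnC !modnMDl. Qed.

Lemma qpoch_iota n : qpoch q q n = \prod_(a <- iota 1 n) (1 - q ^+ a).
Proof.
rewrite /qpoch -[iota _ _]/(iota (1 + 0) n) iotaDl big_map.
rewrite -(big_mkord xpredT (fun i => 1 - q * q ^+ i)).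
by rewrite /index_iota subn0; apply: eq_bigr => i _; rewrite exprS.
Qed.

Lemma prod_forbidden n : \prod_(a <- iota 1 (7 * n) | ~~ allowed a) (1 - q ^+ a) =
  qpoch (q ^+ 7) (q ^+ 3) n * qpoch (q ^+ 7) (q ^+ 4) n * qpoch (q ^+ 7) (q ^+ 7) n.
Proof.
elim: n => [|n IH]; first by rewrite big_nil !qpoch0 !mulr1.
rewrite mulnS addnC iotaD big_cat IH [(1 + _)%N]addnC iotaDl.
rewrite big_map; under eq_bigl => i do rewrite allowed_addMl.
rewrite !big_cons big_nil /= !qpochS !exprD ![q ^+ 7 ^+ n]exprAC.
ring.
Qed.

(** Parts up to $7n$ rather than $n$ are listed so that the forbidden residues
    make up complete products of length $n$ in [prod_forbidden]. *)
Lemma A73_gf n :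
  A73 n = (\sum_(s <- bounded_parts n (rev [seq a <- iota 1 (7 * n) | allowed a])
    | sumn s == n) 1)%N.
Proof.
set r := rev _.
have r_sorted : sorted gtn r.
  by rewrite rev_sorted; apply: sorted_filter; [exact: ltn_trans | exact: iota_ltn_sorted].
have mem_r a : (a \in r) = allowed a && (0 < a <= 7 * n)%N.
  by rewrite mem_rev mem_filter mem_iota; congr (_ && _); lia.
rewrite /A73 -sum1dep_card; apply: (@sum_intpart n (all allowed) (fun=> 1%N)).
  exact: bounded_parts_uniq.
move=> s; rewrite /is_part_of; apply/andP/andP.
  move=> [s_in s_n]; have /andP[s_sorted /allP s_r] := bounded_parts_sound r_sorted s_in.
  rewrite s_sorted s_n; split; last by apply/allP => x /s_r; rewrite /= mem_r => /andP[].
  by rewrite andbT; apply/negP => /s_r; rewrite /= mem_r ltnn andbF.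
move=> [/and3P[s_sorted s0 s_n] /allP s_allowed]; split=> //.
have sz := size_le_sumn s0.
apply: bounded_parts_complete => //; last by rewrite -(eqP s_n).
apply/allP => x x_s; rewrite /= mem_r s_allowed //=.
have x_n := mem_le_sumn x_s.
have : x != 0%N by apply: contraNneq s0 => <-.
move: s_n => /eqP; lia.
Qed.

(** * Comparison of the two generating functions *)

Lemma omega5_gf n : (\sum_(p : intpart n | in_R p) omega5 p)%N%:R =
  (\sum_(N < n.+1) marked_gf n false N 0)`_n :> int.
Proof.
pose L := [seq rev s | N <- iota 0 n.+1, s <- gapped n N 0].
have pw_rev s : pairwise (fun x y => y.+2 <= x)%N (rev s) =
    pairwise (fun x y => x.+2 <= y)%N s.
  rewrite -!sorted_pairwise ?rev_sorted // => y x z; lia.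
have memL s : (s \in L) && (sumn s == n) = is_part_of n s && in_R s.
  rewrite /is_part_of; apply/andP/andP.
    case=> /allpairsPdep[N [t [_ t_in ->]]] s_n; rewrite rev_sorted s_n andbT.
    move: t_in; rewrite mem_gapped => /and3P[_ /allP t_pos t_pw].
    have in_R_t : in_R (rev t).
      by rewrite /in_R -(pw_rev t) in t_pw *; apply: sub_pairwise t_pw => x y; lia.
    rewrite in_R_t mem_rev; split=> //; apply/andP; split.
      rewrite sorted_pairwise => [|y x z]; last by rewrite /geq /=; lia.
      by apply: sub_pairwise t_pw => x y; rewrite /geq /=; lia.
    by apply/negP => /t_pos.
  case=> /and3P[_ s0 s_n] s_R; split=> //.
  have s_pw : pairwise (fun x y => x.+2 <= y)%N (rev s).
    by rewrite -pw_rev revK; apply: sub_pairwise s_R => x y; lia.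
  have sz := size_le_sumn s0.
  apply/allpairsPdep; exists (size s), (rev s); split; last by rewrite revK.
    by rewrite mem_iota add0n ltnS -(eqP s_n).
  rewrite mem_gapped size_rev eqxx s_pw andbT all_rev; apply/allP => x x_s.
  have x_n : (x <= sumn s)%N by apply: mem_le_sumn.
  have : x != 0%N by apply: contraNneq s0 => <-.
  move: s_n => /eqP; lia.
rewrite (@sum_intpart n in_R omega5 L) //; last first.
  apply: allpairs_uniq_dep => [|N _|]; [exact: iota_uniq | exact: gapped_uniq |].
  move=> u v; case/allpairsPdep=> [N [s [_ s_in ->]]].
  case/allpairsPdep=> [N' [t [_ t_in ->]]] /= /(can_inj revK) st.
  rewrite -st in t_in *; move: s_in t_in; rewrite !mem_gapped.
  by move=> /and3P[/eqP <- _ _] /and3P[/eqP <- _ _].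
have sumE N : \sum_(s <- gapped n N 0) (omega5 (rev s))%:R * q ^+ sumn (rev s) =
    marked_gf n false N 0.
  rewrite /marked_gf big_seq [RHS]big_seq; apply: eq_bigr => s.
  rewrite mem_gapped => /and3P[_ /allP s_pos s_pw]; rewrite sumn_rev omega5_rev //.
  by apply/allP => x /s_pos; lia.
rewrite -coef_seq_gf /seq_gf big_allpairs_dep.
rewrite -(big_mkord xpredT (fun N => marked_gf n false N 0)).
by rewrite -(eq_bigr _ (fun N _ => sumE N)) /index_iota subn0.
Qed.

(** Multiplied by $(q)_{7n}$, both generating functions become the product over
    the forbidden residues. For the first one the product over the allowed parts
    cancels; for the second $(q)_{7n}$ agrees with $(q)_n$ modulo $q^{n+1}$. *)
Lemma A73_omega5_int n :
  (A73 n)%:R = (\sum_(p : intpart n | in_R p) omega5 p)%N%:R :> int.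
Proof.
rewrite A73_gf omega5_gf -coef_seq_gf; apply: eqmod_coef.
set r := rev _; set A := seq_gf _ _; set W := \sum_(N < _) _.
pose J := qpoch (q ^+ 7) (q ^+ 3) n * qpoch (q ^+ 7) (q ^+ 4) n * qpoch (q ^+ 7) (q ^+ 7) n.
have r0 : 0%N \notin r by rewrite mem_rev mem_filter.
have inv m : invmod (q ^+ n.+1) (qpoch q q m).
  by apply: (@invmod_qpoch _ _ _ _ _ _ 1); rewrite mulr1.
have qfac_split : qpoch q q (7 * n) = J * \prod_(a <- r) (1 - q ^+ a).
  rewrite qpoch_iota (bigID allowed) /= prod_forbidden mulrC -/J; congr (_ * _).
  by rewrite -big_filter; apply: perm_big; rewrite perm_sym perm_rev.
apply: (eqmod_cancel (inv (7 * n)%N)); apply: (@eqmod_trans _ _ J).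
  rewrite qfac_split -mulrA -[X in eqmod _ _ X]mulr1.
  exact/eqmodMl/bounded_parts_gf.
apply/eqmod_sym; apply: (@eqmod_trans _ _ (qpoch q q n * W)).
  rewrite (_ : 7 * n = n + 6 * n)%N; last by lia.
  rewrite (qpochD q q n) -exprS -mulrA -[X in eqmod _ _ X]mul1r mulrCA; apply: eqmodMr.
  by apply: (@qpoch_eqmod1 _ _ _ _ _ _ 1); rewrite mulr1.
apply: eqmod_trans (R_gf_mod n) _; exact: andrews_gordon_mod.
Qed.

Local Close Scope ring_scope.

Theorem theorem5 (n : nat) :
  A73 n = \sum_(p : intpart n | in_R p) omega5 p.
Proof. by have := A73_omega5_int n; rewrite !natz => -[]. Qed.
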